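(* Let $N,M\ge1$, $\lambda_1,\dots,\lambda_N>0$, $\lambda_C=\sum_{i=1}^N\lambda_i$, and let $b_1,\dots,b_N\ge0$ be not all zero. For $\mathbf{P_C}=(p^c_{ij})\in[0,1]^{N\times M}$ put $\tilde p_j=\frac1{\lambda_C}\sum_{i=1}^N\lambda_ip^c_{ij}$ for $j=1,\dots,M$, and consider the problem of minimizing $$f(\mathbf{P_C})=\sum_{j=1}^M\frac1{\tilde p_j}$$ over all $\mathbf{P_C}\in[0,1]^{N\times M}$ satisfying the quadratic constraints $\sum_{j=1}^M(p^c_{ij})^2\le b_i$ for $i=1,\dots,N$. Then the equal distribution $$p^{c*}_{ij}=\sqrt{\frac{\min(M,b_i)}{M}},\qquad i=1,\dots,N,\ j=1,\dots,M,$$ is a global minimizer.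
   Context: Convention: $1/0=+\infty$, so $f(\mathbf{P_C})=+\infty$ if some $\tilde p_j=0$. *)

(* Defs.v *)
From HB Require Import structures.
From mathcomp Require Export all_boot all_order all_algebra.
From mathcomp Require Export reals constructive_ereal.

Set Implicit Arguments.
Unset Strict Implicit.
Unset Printing Implicit Defensive.

Import Order.TTheory GRing.Theory Num.Theory.

Local Open Scope ring_scope.

Definition ptilde (R : realType) (N M : nat) (lambda : 'I_N -> R)
    (P : 'M[R]_(N, M)) (j : 'I_M) : R :=
  (\sum_(i < N) lambda i)^-1 * \sum_(i < N) lambda i * P i j.

(* The inverse is the one of \bar R, for which 0^-1 = +oo; the inverse of R
   would give 0^-1 = 0. *)
Definition objective (R : realType) (N M : nat) (lambda : 'I_N -> R)
    (P : 'M[R]_(N, M)) : \bar R :=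
  (\sum_(j < M) ((ptilde lambda P j)%:E)^-1)%E.

Definition feasible (R : realType) (N M : nat) (b : 'I_N -> R)
    (P : 'M[R]_(N, M)) : Prop :=
  (forall i j, 0 <= P i j <= 1) /\
  (forall i, \sum_(j < M) P i j ^+ 2 <= b i).

Definition global_minimizer (R : realType) (T : Type) (A : T -> Prop)
    (f : T -> \bar R) (x : T) : Prop :=
  A x /\ forall y, A y -> (f x <= f y)%E.

Definition equal_distribution (R : realType) (N M : nat) (b : 'I_N -> R) :
    'M[R]_(N, M) :=
  \matrix_(i < N, j < M) Num.sqrt (Num.min M%:R (b i) / M%:R).

(* Main.v *)
Require Import Defs.
From mathcomp Require Import ring.

Set Implicit Arguments.
Unset Strict Implicit.
Unset Printing Implicit Defensive.

Import Order.TTheory GRing.Theory Num.Theory.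

(** By Cauchy-Schwarz the constraints bound the i-th row sum of a feasible
    matrix by M c_i, where c_i is the common entry of the i-th row of the equal
    distribution; hence the sum of the ptilde_j is at most M c, where c is the
    lambda-average of the c_i.  The tangent line of 1/p at c,
    1/p >= 2/c - p/c^2, summed over j, then gives f >= M/c, the value at the
    equal distribution. *)

Local Open Scope ring_scope.

(** With [s] and [q] the sums of the [x j] and of their squares, the squared deviations
    [M * x j - s] add up to [M * (M * q - s ^+ 2)], and the factor [M] cancels when positive. *)
Lemma sqr_sum_le_card_sum_sqr (R : realFieldType) (M : nat) (x : 'I_M -> R) :
  (\sum_j x j) ^+ 2 <= M%:R * \sum_j x j ^+ 2.
Proof.
have [M0 | M_gt0] := posnP M.
  by subst M; rewrite !big_ord0 mul0r expr0n.
set s := \sum_j x j; set q := \sum_j x j ^+ 2.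
have M0 : 0 < M%:R :> R by rewrite ltr0n.
have : 0 <= \sum_j (M%:R * x j - s) ^+ 2 by apply: sumr_ge0 => j _; exact: sqr_ge0.
have -> : \sum_j (M%:R * x j - s) ^+ 2 = M%:R * (M%:R * q - s ^+ 2).
  have expand j : (M%:R * x j - s) ^+ 2
      = M%:R ^+ 2 * x j ^+ 2 + (- (2 * M%:R * s) * x j + s ^+ 2) by ring.
  under eq_bigr => j _ do rewrite expand.
  rewrite !big_split /= -!mulr_sumr sumr_const card_ord -/s -/q -mulr_natl; ring.
by rewrite pmulr_rge0 // subr_ge0.
Qed.

(** For [p > 0] the gap is [(p - c) ^+ 2 / (p * c ^+ 2)]; at [p = 0] the right side is [+oo]. *)
Lemma inve_ge_tangent (R : realType) (c p : R) : 0 < c -> 0 <= p ->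
  ((2 / c - p / c ^+ 2)%:E <= (p%:E)^-1)%E.
Proof.
move=> c0; rewrite le_eqVlt => /predU1P[<- | p0].
  by rewrite inve0 leey.
have pn0 : p != 0 by rewrite gt_eqF.
have cn0 : c != 0 by rewrite gt_eqF.
rewrite inver (negPf pn0) lee_fin -subr_ge0.
rewrite (_ : _ - _ = (p - c) ^+ 2 / (p * c ^+ 2)); last by field; rewrite pn0 cn0.
by rewrite divr_ge0 ?sqr_ge0 // mulr_ge0 ?sqr_ge0 // ltW.
Qed.

Lemma equal_distribution_feasible (R : realType) (N M : nat) (b : 'I_N -> R) :
  (0 < M)%N -> (forall i, 0 <= b i) -> feasible b (equal_distribution M b).
Proof.
move=> M_gt0 hb; have M0 : 0 < M%:R :> R by rewrite ltr0n.
have m0 i : 0 <= Num.min M%:R (b i) by rewrite le_min ltW ?hb.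
split=> [i j | i].
  rewrite mxE sqrtr_ge0 /= -[leRHS]sqrtr1 ler_wsqrtr //.
  by rewrite ler_pdivrMr // mul1r ge_min lexx.
have c2 : Num.sqrt (Num.min M%:R (b i) / M%:R) ^+ 2 = Num.min M%:R (b i) / M%:R.
  by rewrite sqr_sqrtr // divr_ge0 // ltW.
under eq_bigr => j _ do rewrite mxE c2.
rewrite sumr_const card_ord -[X in X <= _]mulr_natr divfK ?gt_eqF //.
by rewrite ge_min lexx orbT.
Qed.

(** Entries in [0,1] have squares at most 1, so the squares of a row sum to at most [M] as well as
    [b i]: hence the minimum. Cauchy-Schwarz turns this into a bound on the row sum. *)
Lemma feasible_row_sum_le (R : realType) (N M : nat) (b : 'I_N -> R)
    (P : 'M[R]_(N, M)) (i : 'I_N) : (0 < M)%N -> feasible b P ->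
  \sum_j P i j <= M%:R * Num.sqrt (Num.min M%:R (b i) / M%:R).
Proof.
move=> M_gt0 [P01 Pb]; have M0 : 0 < M%:R :> R by rewrite ltr0n.
have q_le : \sum_j P i j ^+ 2 <= Num.min M%:R (b i).
  rewrite le_min Pb andbT.
  apply: (le_trans (y := \sum_(j < M) 1)); last by rewrite sumr_const card_ord.
  by apply: ler_sum => j _; have /andP[? ?] := P01 i j; rewrite expr_le1.
have m0 : 0 <= Num.min M%:R (b i).
  by apply: le_trans q_le; apply: sumr_ge0 => j _; exact: sqr_ge0.
rewrite -ler_sqr ?nnegrE; last 2 first.
- by apply: sumr_ge0 => j _; have /andP[] := P01 i j.
- by rewrite mulr_ge0 ?sqrtr_ge0 ?ltW.
apply: (le_trans (sqr_sum_le_card_sum_sqr _)).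
rewrite exprMn sqr_sqrtr ?divr_ge0 ?(ltW M0) // expr2 -mulrA ler_pM2l //.
by rewrite mulrC divfK ?gt_eqF.
Qed.

Theorem mainTheorem4 (R : realType) (N M : nat) (hN : (1 <= N)%N)
    (hM : (1 <= M)%N) (lambda b : 'I_N -> R)
    (hlambda : forall i, 0 < lambda i) (hb : forall i, 0 <= b i)
    (hb0 : exists i, b i <> 0) :
  global_minimizer (feasible b) (objective lambda)
    (equal_distribution M b).
Proof.
split=> [|P feasP]; first exact: equal_distribution_feasible.
have M0 : 0 < M%:R :> R by rewrite ltr0n.
pose s i := Num.sqrt (Num.min M%:R (b i) / M%:R).
pose c := (\sum_i lambda i)^-1 * \sum_i lambda i * s i.
(* The term of index [i0] is positive and the others are nonnegative, both in the sum of the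
   [lambda i] and in that defining [c]. *)
have [i0 /eqP bi0] := hb0.
have L0 : 0 < \sum_i lambda i.
  rewrite (bigD1 i0) //= ltr_pwDl // sumr_ge0 // => i _; exact: ltW.
have c0 : 0 < c.
  rewrite mulr_gt0 ?invr_gt0 // (bigD1 i0) //= ltr_pwDl //.
    by rewrite mulr_gt0 // sqrtr_gt0 divr_gt0 // lt_min M0 lt0r bi0 hb.
  by rewrite sumr_ge0 // => i _; rewrite mulr_ge0 ?sqrtr_ge0 // ltW.
have cn0 : c != 0 by rewrite gt_eqF.
have ptilde_equal j : ptilde lambda (equal_distribution M b) j = c.
  by congr (_ * _); apply: eq_bigr => i _; rewrite mxE.
have ptilde_ge0 j : 0 <= ptilde lambda P j.
  rewrite mulr_ge0 ?invr_ge0 ?(ltW L0) // sumr_ge0 // => i _.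
  by have [/(_ i j)/andP[Pij0 _] _] := feasP; rewrite mulr_ge0 // ltW.
have sum_ptilde : \sum_j ptilde lambda P j <= M%:R * c.
  rewrite -mulr_sumr exchange_big /= mulrCA ler_pM2l ?invr_gt0 //.
  rewrite mulr_sumr ler_sum // => i _.
  rewrite -mulr_sumr mulrCA ler_pM2l //.
  exact: feasible_row_sum_le.
rewrite /objective.
(* The sum of the tangents is finite, so its comparison with [M / c] takes place in [R]; infinite
   terms can occur only in the termwise tangent bound. *)
apply: (@le_trans _ _ (\sum_(j < M) (2 / c - ptilde lambda P j / c ^+ 2)%:E)%E).
  under eq_bigr => j _ do rewrite ptilde_equal inver (negPf cn0).
  rewrite !sumEFin lee_fin sumrB !sumr_const card_ord -mulr_suml.
  rewrite -(mulr_natl (2 / c)) -(mulr_natl c^-1) -subr_ge0.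
  (* The tangents sum to [2 * M / c - S / c ^+ 2], with [S] the sum of the [ptilde]; [S <= M * c]
     makes the excess over [M / c] nonnegative. *)
  rewrite (_ : _ - _ = (M%:R * c - \sum_j ptilde lambda P j) / c ^+ 2);
    last by field.
  by rewrite divr_ge0 ?sqr_ge0 // subr_ge0.
by apply: lee_sum => j _; exact: inve_ge_tangent.
Qed.
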